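(* Let $d\ge2$, $\varepsilon>0$, $N\in\mathbb{N}$, weights $w_1,\dots,w_N>0$, and let $v_1(t),\dots,v_N(t)\in\mathbb{R}^d$ be a (differentiable) solution of the semidiscrete particle system \[ \frac{dv_i}{dt}=-\sum_{j=1}^N w_jA(v_i-v_j)\left[\nabla\frac{\delta E^N_\varepsilon}{\delta f}(v_i)-\nabla\frac{\delta E^N_\varepsilon}{\delta f}(v_j)\right],\qquad i=1,\dots,N, \] where \[ \nabla\frac{\delta E^N_\varepsilon}{\delta f}(x)=\int_{\mathbb{R}^d}\nabla\psi_\varepsilon(x-v)\log\Big(\sum_{k=1}^N w_k\psi_\varepsilon(v-v_k(t))\Big)\,\mathrm{d}v . \] Then: 1) $\frac{d}{dt}\sum_{i=1}^N w_i\phi(v_i)=0$ for $\phi(v)=1$, $\phi(v)=v$ and $\phi(v)=|v|^2$ (conservation of mass, momentum and energy); 2) with the discrete entropy $E^N_\varepsilon=\int_{\mathbb{R}^d}(f^N*\psi_\varepsilon)\log(f^N*\psi_\varepsilon)\,\mathrm{d}v$, where $f^N(t,v)=\sum_{i=1}^Nw_i\delta(v-v_i(t))$, one has $\frac{d}{dt}E^N_\varepsilon=-D^N_\varepsilon\le0$, where \[ D^N_\varepsilon=\frac12\sum_{i,j}w_iw_j\left(\nabla\frac{\delta E^N_\varepsilon}{\delta f}(v_i)-\nabla\frac{\delta E^N_\varepsilon}{\delta f}(v_j)\right)\cdot A(v_i-v_j)\left(\nabla\frac{\delta E^N_\varepsilon}{\delta f}(v_i)-\nabla\frac{\delta E^N_\varepsilon}{\delta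 f}(v_j)\right). \]
   Context: $A(z)=|z|^{\gamma}(|z|^2I_d-z\otimes z)$ for a fixed exponent $\gamma$, with $A(0)=0$ understood where needed; $A(z)$ is symmetric positive semidefinite with kernel spanned by $z$. $\psi_\varepsilon(v)=(2\pi\varepsilon)^{-d/2}\exp(-|v|^2/(2\varepsilon))$ is the Gaussian mollifier, and $f^N*\psi_\varepsilon(v)=\sum_i w_i\psi_\varepsilon(v-v_i(t))$. *)

(* Defs.v *)
From HB Require Import structures.
From mathcomp Require Import all_boot all_order all_algebra.
From mathcomp Require Import all_classical all_reals all_analysis.
Set Implicit Arguments. Unset Strict Implicit. Unset Printing Implicit Defensive.
Import Order.TTheory GRing.Theory Num.Theory.
Import numFieldNormedType.Exports.
Local Open Scope ring_scope.

Section LandauDefs.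
Variable R : realType.

Definition dotv (d : nat) (u v : 'rV[R]_d) : R := \sum_(k < d) u 0 k * v 0 k.
Definition sqnorm (d : nat) (u : 'rV[R]_d) : R := dotv u u.
Definition enorm (d : nat) (u : 'rV[R]_d) : R := Num.sqrt (sqnorm u).

Definition Amat (gamma : R) (d : nat) (z : 'rV[R]_d) : 'M[R]_d :=
  if z == 0 then 0
  else (enorm z `^ gamma) *: (sqnorm z *: 1%:M - z^T *m z).

Definition mxapp (d : nat) (M : 'M[R]_d) (v : 'rV[R]_d) : 'rV[R]_d :=
  (M *m v^T)^T.

Definition psi (eps : R) (d : nat) (v : 'rV[R]_d) : R :=
  (2 * pi * eps) `^ (- (d%:R / 2)) * expR (- sqnorm v / (2 * eps)).

Definition grad (d : nat) (f : 'rV[R]_d -> R) (x : 'rV[R]_d) : 'rV[R]_d :=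
  \row_(k < d) derive f x (delta_mx 0 k).

(* Lebesgue integral over R^d, written as the iterated integral over the
   coordinates (equal to the Lebesgue integral on R^d for integrable
   functions by Fubini). *)
Fixpoint intRd (d : nat) : ('rV[R]_d -> R) -> R :=
  match d return ('rV[R]_d -> R) -> R with
  | 0 => fun f => f 0
  | d'.+1 => fun f =>
      Rintegral lebesgue_measure setT
        (fun x : R => intRd (fun y : 'rV[R]_d' =>
           f (row_mx (\row_(_ < 1) x) y)))
  end.

Definition fNpsi (eps : R) (d N : nat) (w : 'I_N -> R)
  (v : 'I_N -> R -> 'rV[R]_d) (t : R) (y : 'rV[R]_d) : R :=
  \sum_(i < N) w i * psi eps (y - v i t).

Definition gradE (eps : R) (d N : nat) (w : 'I_N -> R)
  (v : 'I_N -> R -> 'rV[R]_d) (t : R) (x : 'rV[R]_d) : 'rV[R]_d :=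
  \row_(k < d) intRd (fun y => (grad (psi eps (d:=d)) (x - y)) 0 k
                                 * ln (fNpsi eps w v t y)).

Definition entropyN (eps : R) (d N : nat) (w : 'I_N -> R)
  (v : 'I_N -> R -> 'rV[R]_d) (t : R) : R :=
  intRd (fun y => fNpsi eps w v t y * ln (fNpsi eps w v t y)).

Definition dissipN (gamma eps : R) (d N : nat) (w : 'I_N -> R)
  (v : 'I_N -> R -> 'rV[R]_d) (t : R) : R :=
  2^-1 * \sum_(i < N) \sum_(j < N)
    w i * w j *
    dotv (gradE eps w v t (v i t) - gradE eps w v t (v j t))
         (mxapp (Amat gamma (v i t - v j t))
                (gradE eps w v t (v i t) - gradE eps w v t (v j t))).

Definition particle_rhs (gamma eps : R) (d N : nat) (w : 'I_N -> R)
  (v : 'I_N -> R -> 'rV[R]_d) (t : R) (i : 'I_N) : 'rV[R]_d :=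
  - \sum_(j < N) w j *: mxapp (Amat gamma (v i t - v j t))
        (gradE eps w v t (v i t) - gradE eps w v t (v j t)).

End LandauDefs.

(* Main.v *)
(** The entropy depends on time only through the Gaussian mixture
    [m s y = \sum_i w_i psi (y - v_i s)].  As the mass of [m s] does not depend on
    [s], its entropy is, up to a constant, the integral of [eta (m s)] with
    [eta u = u ln u - u], and [eta' = ln].  Near a time where the particles are
    differentiable, the increments of [eta (m s y)] are bounded by [|s - t|] times
    a polynomial in [y] times a Gaussian, so dominated convergence gives
    [dE/dt = \int (d_t m) ln m = \sum_i w_i <v_i', gradE (v_i)>].

    All conservation laws and the dissipation identity are then instances of one
    symmetrized weak form: since [A(v_i - v_j)(g_i - g_j)] is antisymmetric in
    [(i, j)], testing the system against [a_i] only involves [a_i - a_j].  It vanishes for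
    constant [a], and for [a_i = v_i] because [A(z) z = 0]; for [a_i = g_i] it
    is [-D], which has a sign by Cauchy-Schwarz.

    [intRd] being an iterated integral, no Fubini theorem is needed: dominated
    convergence and linearity are proved by induction on the dimension, on the
    class of continuous functions bounded by a centered Gaussian; the Gaussian
    majorant factorizes and continuity makes the partial integrals measurable. *)
Require Import Defs.
From HB Require Import structures.
From mathcomp Require Import all_boot all_order all_algebra.
From mathcomp Require Import all_classical all_reals all_analysis.
From mathcomp Require Import measurable_realfun ring lra.
Import Order.TTheory GRing.Theory Num.Theory.
Import numFieldNormedType.Exports.
Local Open Scope ring_scope.
Local Open Scope classical_set_scope.

Set Implicit Arguments.
Unset Strict Implicit.
Unset Printing Implicit Defensive.

(** * Slices of row vectors, sequential continuity, Gaussian domination *)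

(** The same term as in the recursion of [intRd], so that [intRdS] holds by conversion. *)
Definition rv_cons (R : realType) (d : nat) (x : R) (y : 'rV[R]_d) : 'rV[R]_d.+1 :=
  row_mx (\row_(_ < 1) x) y.

Definition rv_behead (R : realType) (d : nat) (y : 'rV[R]_d.+1) : 'rV[R]_d :=
  \row_j y 0 (lift ord0 j).

(** Continuity in sequential, coordinatewise form: it passes to slices at once and matches the
    sequences of dominated convergence. *)
Definition seqcont (R : realType) (d : nat) (f : 'rV[R]_d -> R) :=
  forall (u : nat -> 'rV[R]_d) (l : 'rV[R]_d),
    (forall k, u n 0 k @[n --> \oo] --> l 0 k) -> f (u n) @[n --> \oo] --> f l.

Definition gauss (R : realType) (c : R) (d : nat) (y : 'rV[R]_d) : R :=
  expR (- c * sqnorm y).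

(** The class on which [intRd] is linear; the rate [c] is fixed, the constant is free. *)
Definition gdom (R : realType) (c : R) (d : nat) (f : 'rV[R]_d -> R) :=
  seqcont f /\ exists C, forall y, `|f y| <= C * gauss c y.

(** * Row vectors and Gaussians *)

Section Rows.
Context {R : realType}.
Implicit Types (x c : R) (d : nat).

Lemma rv_cons0 d x (y : 'rV[R]_d) : rv_cons x y 0 ord0 = x.
Proof.
have -> : ord0 = lshift d (ord0 : 'I_1) by exact: val_inj.
by apply: etrans (row_mxEl _ _ _ _) _; rewrite mxE.
Qed.

Lemma rv_consS d x (y : 'rV[R]_d) k : rv_cons x y 0 (lift ord0 k) = y 0 k.
Proof.
have -> : lift ord0 k = rshift 1 k by exact: val_inj.
exact: row_mxEr.
Qed.

Lemma sqnorm_recl d (y : 'rV[R]_d.+1) :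
  sqnorm y = y 0 ord0 ^+ 2 + sqnorm (rv_behead y).
Proof.
rewrite /sqnorm /dotv big_ord_recl expr2; congr (_ + _).
by apply: eq_bigr => k _; rewrite !mxE.
Qed.

Lemma rv_behead_consB d x (y : 'rV[R]_d) (a : 'rV[R]_d.+1) :
  rv_behead (rv_cons x y - a) = y - rv_behead a.
Proof. by apply/rowP => k; rewrite mxE [LHS]mxE rv_consS !mxE. Qed.

Lemma sqnorm_ge0 d (y : 'rV[R]_d) : 0 <= sqnorm y.
Proof. by apply: sumr_ge0 => k _; rewrite -expr2 sqr_ge0. Qed.

Lemma sqnormN d (y : 'rV[R]_d) : sqnorm (- y) = sqnorm y.
Proof. by apply: eq_bigr => k _; rewrite mxE mulrNN. Qed.

Lemma gaussN c d (y : 'rV[R]_d) : gauss c (- y) = gauss c y.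
Proof. by rewrite /gauss sqnormN. Qed.

Lemma gauss_cons c d x (y : 'rV[R]_d) :
  gauss c (rv_cons x y) = expR (- c * x ^+ 2) * gauss c y.
Proof.
rewrite /gauss -expRD -mulrDr sqnorm_recl rv_cons0.
congr (expR (_ * (_ + sqnorm _))).
by apply/rowP => k; rewrite mxE rv_consS.
Qed.

Lemma gauss_gt0 c d (y : 'rV[R]_d) : 0 < gauss c y.
Proof. exact: expR_gt0. Qed.

Lemma rv_cons_cvg d (u : nat -> R) (v : nat -> 'rV[R]_d) (l : R) (m : 'rV[R]_d) :
  u n @[n --> \oo] --> l -> (forall k, v n 0 k @[n --> \oo] --> m 0 k) ->
  forall k, rv_cons (u n) (v n) 0 k @[n --> \oo] --> rv_cons l m 0 k.
Proof.
move=> ul vm k; have [j ->|->] := unliftP ord0 k.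
- by rewrite rv_consS; under eq_fun do rewrite rv_consS; exact: vm.
- by rewrite rv_cons0; under eq_fun do rewrite rv_cons0.
Qed.

Lemma seqcont_cons d (f : 'rV[R]_d.+1 -> R) x :
  seqcont f -> seqcont (fun y => f (rv_cons x y)).
Proof. by move=> fc v l vl; apply/fc/rv_cons_cvg => //; exact: cvg_cst. Qed.

(** Up to its normalization this is the normal density of variance $1/(2c)$. *)
Lemma integrable_gauss1 c : 0 < c ->
  (@lebesgue_measure R).-integrable setT (EFin \o (fun x => expR (- c * x ^+ 2))).
Proof.
move=> c0; pose s := Num.sqrt (2 * c)^-1.
have s2 : s ^+ 2 = (2 * c)^-1 by rewrite sqr_sqrtr// invr_ge0 mulr_ge0// ltW.
have s0 : s != 0 by rewrite gt_eqF// sqrtr_gt0 invr_gt0 mulr_gt0.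
have := integrableZl measurableT (normal_peak s)^-1 (integrable_normal_pdf 0 s).
congr (integrable _ _ _); apply/funext => x /=.
rewrite -EFinM (normal_pdfE 0 s0) mulKf ?gt_eqF ?normal_peak_gt0//.
congr (expR _)%:E; rewrite subr0 s2 -mulr_natr; field.
by rewrite gt_eqF.
Qed.

(** Normal densities have mass 1 whatever their mean, so both sides equal the inverse of the same
    peak value. *)
Lemma Rintegral_gauss1_center c a : 0 < c ->
  \int[lebesgue_measure]_x expR (- c * (x - a) ^+ 2) =
  \int[lebesgue_measure]_x expR (- c * x ^+ 2) :> R.
Proof.
move=> c0; pose s := Num.sqrt (2 * c)^-1.
have s2 : s ^+ 2 = (2 * c)^-1 by rewrite sqr_sqrtr// invr_ge0 mulr_ge0// ltW.
have s0 : s != 0 by rewrite gt_eqF// sqrtr_gt0 invr_gt0 mulr_gt0.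
have E b : \int[lebesgue_measure]_x expR (- c * (x - b) ^+ 2) = (normal_peak s)^-1 :> R.
  have I1 : \int[lebesgue_measure]_x normal_pdf b s x = 1 :> R.
    by rewrite /Rintegral integral_normal_pdf.
  rewrite -[RHS]mulr1 -I1 -RintegralZl//; last exact: integrable_normal_pdf.
  apply: eq_Rintegral => x _.
  rewrite (normal_pdfE b s0) mulKf ?gt_eqF ?normal_peak_gt0//.
  congr (expR _); rewrite s2 -mulr_natr; field.
  by rewrite gt_eqF.
by rewrite E; under eq_Rintegral do rewrite -[X in X ^+ 2]subr0; rewrite E.
Qed.

End Rows.

(** * Iterated integrals of functions dominated by a Gaussian *)

Section IntRd.
Context {R : realType}.
Variable c : R.
Hypothesis c0 : 0 < c.
Implicit Type d : nat.
Local Notation mu := (@lebesgue_measure R).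
Local Notation K := (\int[mu]_x expR (- c * x ^+ 2)).

Definition intRd_le d := forall (f : 'rV[R]_d -> R) C,
  seqcont f -> (forall y, `|f y| <= C * gauss c y) -> `|intRd f| <= C * K ^+ d.

Definition intRd_dct d :=
  forall (f_ : nat -> 'rV[R]_d -> R) (f : 'rV[R]_d -> R) C,
    (forall n, seqcont (f_ n)) -> seqcont f ->
    (forall n y, `|f_ n y| <= C * gauss c y) ->
    (forall y, f_ n y @[n --> \oo] --> f y) ->
    intRd (f_ n) @[n --> \oo] --> intRd f.

Lemma intRdS d (f : 'rV[R]_d.+1 -> R) :
  intRd f = \int[mu]_x intRd (fun y => f (rv_cons x y)).
Proof. by []. Qed.

Lemma gauss_dom_ge0 d (f : 'rV[R]_d -> R) C :
  (forall y, `|f y| <= C * gauss c y) -> 0 <= C.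
Proof.
by move=> /(_ 0) /(le_trans (normr_ge0 _)); rewrite pmulr_lge0// gauss_gt0.
Qed.

Lemma gauss1_le1 (x : R) : expR (- c * x ^+ 2) <= 1.
Proof. by rewrite -expR0 ler_expR mulNr oppr_le0 mulr_ge0 ?sqr_ge0// ltW. Qed.

Lemma gauss_dom_cons d (f : 'rV[R]_d.+1 -> R) C x :
  (forall y, `|f y| <= C * gauss c y) ->
  forall y, `|f (rv_cons x y)| <= (C * expR (- c * x ^+ 2)) * gauss c y.
Proof. by move=> fC y; rewrite -mulrA -gauss_cons. Qed.

(** Dominated convergence in dimension [d] along $u_n \to x$; the Gaussian factor in the first
    coordinate is at most 1, so one majorant serves all $u_n$. Measurability of the slice integral
    follows. *)
Lemma slice_continuous d (f : 'rV[R]_d.+1 -> R) C : intRd_dct d ->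
  seqcont f -> (forall y, `|f y| <= C * gauss c y) ->
  continuous (fun x : R => intRd (fun y => f (rv_cons x y))).
Proof.
move=> dct fc fC x; apply/(@cvg_nbhsP _ R^o) => u ux.
apply: (dct _ _ C) => [n||n y|y]; [exact: seqcont_cons..| |].
- apply: le_trans (gauss_dom_cons _ fC y) _.
  rewrite ler_wpM2r ?(ltW (gauss_gt0 _ _))//.
  by rewrite ler_piMr ?gauss1_le1 ?(gauss_dom_ge0 fC).
- by apply: fc; apply: rv_cons_cvg => // k; exact: cvg_cst.
Qed.

Lemma slice_le d (f : 'rV[R]_d.+1 -> R) C x : intRd_le d ->
  seqcont f -> (forall y, `|f y| <= C * gauss c y) ->
  `|intRd (fun y => f (rv_cons x y))| <= (C * K ^+ d) * expR (- c * x ^+ 2).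
Proof.
move=> le_d fc fC; rewrite mulrAC; apply: le_d; first exact: seqcont_cons.
exact: gauss_dom_cons.
Qed.

Lemma dominated_gauss1_integrable (g : R -> R) C : continuous g ->
  (forall x, `|g x| <= C * expR (- c * x ^+ 2)) ->
  mu.-integrable setT (EFin \o g).
Proof.
move=> gc gC; have := integrableZl measurableT C (integrable_gauss1 c0).
apply: le_integrable => //.
  by apply/measurable_EFinP; exact: continuous_measurable_fun.
by move=> x _ /=; rewrite lee_fin; apply: le_trans (gC x) (ler_norm _).
Qed.

(** Both statements go through one induction: in dimension [d] the convergence makes slice integrals
    continuous, and the bound gives them a one-dimensional Gaussian majorant. *)
Lemma intRd_le_dct d : intRd_le d /\ intRd_dct d.
Proof.
elim: d => [|d [le_d dct_d]].
  split=> [f C _ fC|f_ f C _ _ _ fc]; last exact: fc.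
  by rewrite expr0 mulr1; apply: le_trans (fC 0) _;
    rewrite /gauss /sqnorm /dotv big_ord0 mulr0 expR0 mulr1.
split=> [f C fc fC|f_ f C fc_ fc fC f_f].
  have gc := slice_continuous dct_d fc fC.
  have gC x := slice_le x le_d fc fC.
  have gi := dominated_gauss1_integrable gc gC.
  rewrite intRdS; apply: le_trans (le_normr_Rintegral _ gi) _ => //.
  rewrite exprSr mulrA -RintegralZl ?integrable_gauss1//.
  apply: le_Rintegral => //; first exact: integrable_norm.
  exact: integrableZl (integrable_gauss1 c0).
(* The limit inherits the bound, so its own slices are continuous and integrable. *)
have fC' y : `|f y| <= C * gauss c y.
  have cf : `|f_ n y| @[n --> \oo] --> `|f y| by apply: cvg_norm; exact: f_f.
  rewrite -(cvg_lim _ cf)//.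
  by apply: limr_le; [exact: cvgP cf|exact: nearW].
have gc_ n := slice_continuous dct_d (fc_ n) (fC n).
have gC_ n x := slice_le x le_d (fc_ n) (fC n).
have gc := slice_continuous dct_d fc fC'.
have gC x := slice_le x le_d fc fC'.
have gi := dominated_gauss1_integrable gc gC.
rewrite intRdS; under eq_fun do rewrite intRdS.
have mg (h : R -> R) : continuous h -> measurable_fun setT (EFin \o h).
  by move=> hc; apply/measurable_EFinP; exact: continuous_measurable_fun.
have [] := @dominated_convergence _ _ _ mu setT measurableT
  (fun n => EFin \o (fun x => intRd (fun y => f_ n (rv_cons x y))))
  (EFin \o (fun x => intRd (fun y => f (rv_cons x y))))
  (EFin \o (fun x => (C * K ^+ d) * expR (- c * x ^+ 2))).
- by move=> n; exact: mg.
- exact: mg.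
(* Pointwise convergence in [x] is the induction hypothesis on the slice at [x]. *)
- apply: aeW => x _; apply: cvg_EFin; first exact: nearW.
  apply: (dct_d _ _ (C * expR (- c * x ^+ 2))) => [n||n|y].
  + exact: seqcont_cons.
  + exact: seqcont_cons.
  + exact: gauss_dom_cons.
  + exact: f_f.
- exact: integrableZl (integrable_gauss1 c0).
- by apply: aeW => x n _ /=; rewrite lee_fin.
move=> _ _ cvgI; apply: fine_cvg; apply: cvg_trans cvgI _.
by rewrite /Rintegral fineK//; exact: integrable_fin_num.
Qed.

Lemma slice_integrable d (f : 'rV[R]_d.+1 -> R) : gdom c f ->
  mu.-integrable setT (EFin \o (fun x => intRd (fun y => f (rv_cons x y)))).
Proof.
move=> [fc [C fC]]; have [le_d dct_d] := intRd_le_dct d.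
apply: (dominated_gauss1_integrable (C := C * K ^+ d)).
  exact: slice_continuous fC.
by move=> x; exact: slice_le.
Qed.

Lemma gdom_cons d (f : 'rV[R]_d.+1 -> R) x : gdom c f ->
  gdom c (fun y => f (rv_cons x y)).
Proof.
move=> [fc [C fC]]; split; first exact: seqcont_cons.
by exists (C * expR (- c * x ^+ 2)); exact: gauss_dom_cons.
Qed.

(** * Stability of the dominated class and linearity of the iterated integral *)

Lemma seqcontD d (f g : 'rV[R]_d -> R) :
  seqcont f -> seqcont g -> seqcont (fun y => f y + g y).
Proof. by move=> fc gc u l ul; apply: cvgD; [exact: fc|exact: gc]. Qed.

Lemma seqcontM d (f g : 'rV[R]_d -> R) :
  seqcont f -> seqcont g -> seqcont (fun y => f y * g y).
Proof. by move=> fc gc u l ul; apply: cvgM; [exact: fc|exact: gc]. Qed.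

Lemma seqcont_cst d (k : R) : seqcont (fun _ : 'rV[R]_d => k).
Proof. by move=> u l _; exact: cvg_cst. Qed.

Lemma gdomD d (f g : 'rV[R]_d -> R) :
  gdom c f -> gdom c g -> gdom c (fun y => f y + g y).
Proof.
move=> [fc [C fC]] [gc [D gD]]; split; first exact: seqcontD.
exists (C + D) => y; rewrite mulrDl; apply: le_trans (ler_normD _ _) _.
exact: lerD.
Qed.

Lemma gdomZ d (k : R) (f : 'rV[R]_d -> R) :
  gdom c f -> gdom c (fun y => k * f y).
Proof.
move=> [fc [C fC]]; split; first by apply: seqcontM => //; exact: seqcont_cst.
by exists (`|k| * C) => y; rewrite normrM -mulrA ler_wpM2l.
Qed.

Lemma gdom_sum d (I : Type) (s : seq I) (f : I -> 'rV[R]_d -> R) :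
  (forall i, gdom c (f i)) -> gdom c (fun y => \sum_(i <- s) f i y).
Proof.
move=> fi; elim: s => [|i s ih].
  under eq_fun do rewrite big_nil.
  split; first exact: seqcont_cst.
  by exists 0 => y; rewrite normr0 mul0r.
by under eq_fun do rewrite big_cons; exact: gdomD.
Qed.

Lemma intRdD d (f g : 'rV[R]_d -> R) : gdom c f -> gdom c g ->
  intRd (fun y => f y + g y) = intRd f + intRd g.
Proof.
elim: d f g => [//|d ih] f g fc gc.
rewrite !intRdS -RintegralD//; [|exact: slice_integrable..].
by apply: eq_Rintegral => x _; rewrite ih//; exact: gdom_cons.
Qed.

Lemma intRdZ d (k : R) (f : 'rV[R]_d -> R) : gdom c f ->
  intRd (fun y => k * f y) = k * intRd f.
Proof.
elim: d f => [//|d ih] f fc.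
rewrite !intRdS -RintegralZl//; last exact: slice_integrable.
by apply: eq_Rintegral => x _; rewrite ih//; exact: gdom_cons.
Qed.

Lemma intRd_sum d (I : Type) (s : seq I) (f : I -> 'rV[R]_d -> R) :
  (forall i, gdom c (f i)) ->
  intRd (fun y => \sum_(i <- s) f i y) = \sum_(i <- s) intRd (f i).
Proof.
move=> fi; elim: s => [|i s ih].
  (* The integral of the empty sum vanishes by homogeneity with factor 0. *)
  rewrite big_nil -[RHS](mul0r (intRd (fun y => \sum_(i <- [::]) f i y))).
  rewrite -intRdZ; last exact: gdom_sum.
  by congr intRd; apply/funext => y; rewrite big_nil mul0r.
rewrite big_cons -ih -intRdD//; last exact: gdom_sum.
by under eq_fun do rewrite big_cons.
Qed.

(* Only increments from the fixed time [t] are controlled: the particle velocities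
   are known at each time, but need not be bounded near [t] (a very negative
   [gamma] makes [A] singular at collisions). *)
Lemma is_derive_intRd d (f : R -> 'rV[R]_d -> R) (f' : 'rV[R]_d -> R) (t C : R) :
  (forall s, gdom c (f s)) -> seqcont f' ->
  (forall y, is_derive t 1 (f ^~ y) (f' y)) ->
  (\forall s \near t, forall y, `|f s y - f t y| <= C * `|s - t| * gauss c y) ->
  is_derive t 1 (fun s => intRd (f s)) (intRd f').
Proof.
move=> fg f'c df fC.
suff H : h^-1 *: (intRd (f (h *: 1 + t)) - intRd (f t)) @[h --> 0^'] --> intRd f'.
  by apply: DeriveDef; [exact: cvgP H|exact: cvg_lim H].
(* The limit is tested on sequences of nonzero increments, as dominated convergence is
   sequential. *)
apply/cvgr_dnbhsP => u [u0 ucvg].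
have [M _ HM] : \forall n \near \oo, forall y,
    `|f (u n + t) y - f t y| <= C * `|u n| * gauss c y.
  have /ucvg : \forall h \near (0 : R), forall y,
      `|f (h + t) y - f t y| <= C * `|h| * gauss c y.
    move: fC; rewrite (near_shift 0 t); apply: filterS => h /= H y.
    by have := H y; rewrite subr0 addrK.
  by [].
(* The majorant must hold at every index, so the sequence is started at [M]. *)
rewrite -(cvg_shiftn M).
have E n : intRd (fun y => (u n)^-1 * (f (u n + t) y + (-1) * f t y)) =
    (u n)^-1 *: (intRd (f (u n *: 1 + t)) - intRd (f t)).
  rewrite intRdZ; last by apply: gdomD => //; exact: gdomZ.
  by rewrite intRdD// ?intRdZ ?mulN1r ?[_ *: 1]mulr1//; exact: gdomZ.
rewrite /=; under eq_fun do rewrite -E.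
have [_ dct] := intRd_le_dct d; apply: (dct _ _ C) => // [n|n y|y].
- apply: seqcontM; first exact: seqcont_cst.
  apply: seqcontD; first by have [] := fg (u (n + M)%N + t).
  by apply: seqcontM; [exact: seqcont_cst|have [] := fg t].
- rewrite mulN1r normrM normfV ler_pdivrMl ?normr_gt0//.
  by rewrite mulrCA mulrA; apply: HM; rewrite /= leq_addl.
- have [/cvg_ex[l dl] <-] := df y; rewrite /derive (cvg_lim _ dl)//.
  rewrite (cvg_shiftn M (fun n => (u n)^-1 * (f (u n + t) y + (-1) * f t y))).
  move/cvgr_dnbhsP : dl => /(_ u (conj u0 ucvg)).
  have q n : (u n)^-1 * (f (u n + t) y + (-1) * f t y) =
      (u n)^-1 *: ((f ^~ y \o shift t) (u n *: 1) - f t y).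
    by rewrite mulN1r /= [u n *: 1]mulr1.
  by under [in X in _ -> X]eq_fun do rewrite q.
Qed.

End IntRd.

(** * Translated Gaussians *)

Section Gaussian.
Context {R : realType}.
Implicit Types (c : R) (d : nat).

Lemma seqcont_comp d (f : 'rV[R]_d -> R) (g : R -> R) :
  (forall y, {for f y, continuous g}) -> seqcont f -> seqcont (fun y => g (f y)).
Proof. by move=> gc fc u l ul; apply: continuous_cvg; [exact: gc|exact: fc]. Qed.

Lemma seqcont_coord d k : seqcont (fun y : 'rV[R]_d => y 0 k).
Proof. by move=> u l; exact. Qed.

Lemma seqcont_sum d (I : Type) (s : seq I) (f : I -> 'rV[R]_d -> R) :
  (forall i, seqcont (f i)) -> seqcont (fun y => \sum_(i <- s) f i y).
Proof.
move=> fc; elim: s => [|i s ih].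
  by under eq_fun do rewrite big_nil; exact: seqcont_cst.
by under eq_fun do rewrite big_cons; exact: seqcontD.
Qed.

Lemma seqcont_coordB d (a : 'rV[R]_d) k : seqcont (fun y => (y - a) 0 k).
Proof.
under eq_fun do rewrite !mxE.
by apply: seqcontD; [exact: seqcont_coord|exact: seqcont_cst].
Qed.

Lemma seqcont_gaussB c d (a : 'rV[R]_d) : seqcont (fun y => gauss c (y - a)).
Proof.
apply: (seqcont_comp (g := expR)) => [y|]; first exact: continuous_expR.
apply: seqcontM; first exact: seqcont_cst.
by apply: seqcont_sum => k; apply: seqcontM; exact: seqcont_coordB.
Qed.

(** The difference of the two sides is $|y-2a|^2$. *)
Lemma sqnorm_le_center d (y a : 'rV[R]_d) :
  sqnorm y <= 2 * sqnorm (y - a) + 2 * sqnorm a.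
Proof.
rewrite /sqnorm /dotv !mulr_sumr -big_split ler_sum//= => k _; rewrite !mxE.
by have := sqr_ge0 (y 0 k - a 0 k - a 0 k); nra.
Qed.

(** Recentering a Gaussian costs half of its rate; this brings translates into the centered
    class. *)
Lemma gauss_center_le c d (y a : 'rV[R]_d) : 0 <= c ->
  gauss c (y - a) <= expR (c * sqnorm a) * gauss (c / 2) y.
Proof.
move=> c0; rewrite /gauss -expRD ler_expR.
by have := ler_wpM2l c0 (sqnorm_le_center y a); lra.
Qed.

Lemma gauss_center_ge c d (y a : 'rV[R]_d) : 0 <= c ->
  expR (- (2 * c) * (sqnorm y + sqnorm a)) <= gauss c (y - a).
Proof.
move=> c0; rewrite /gauss ler_expR.
have := ler_wpM2l c0 (sqnorm_le_center (y - a) (- a)).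
by rewrite sqnormN opprK subrK; lra.
Qed.

Lemma gdom_gaussB c d (a : 'rV[R]_d) : 0 <= c ->
  gdom (c / 2) (fun y => gauss c (y - a)).
Proof.
move=> c0; split; first exact: seqcont_gaussB.
exists (expR (c * sqnorm a)) => y.
by rewrite ger0_norm ?gauss_center_le// ltW// gauss_gt0.
Qed.

(** The Gaussian splits into coordinates, and each one-dimensional integral ignores its center. *)
Lemma intRd_gaussB c d (a : 'rV[R]_d) : 0 < c ->
  intRd (fun y => gauss c (y - a)) =
    (\int[lebesgue_measure]_x expR (- c * x ^+ 2)) ^+ d.
Proof.
move=> c0; have c20 : 0 < c / 2 by rewrite divr_gt0.
elim: d a => [|d ih] a.
  by rewrite /= /gauss /sqnorm /dotv big_ord0 mulr0 expR0 expr0.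
rewrite intRdS exprS -(ih (rv_behead a)) -(Rintegral_gauss1_center (a 0 ord0) c0).
rewrite -RintegralZr//; last first.
  apply: (dominated_gauss1_integrable c20 (C := expR (c * a 0 ord0 ^+ 2))).
    move=> x; apply: continuous_comp; last exact: continuous_expR.
    apply: cvgM; first exact: cvg_cst.
    apply: (cvg_comp (fun x => x - _) (fun x => x ^+ 2)).
      by apply: (@cvgB _ R^o) => //; [exact: cvg_id|exact: cvg_cst].
    exact: sqr_continuous.
  move=> x; rewrite ger0_norm ?expR_ge0// -expRD ler_expR.
  by have := mulr_ge0 (ltW c0) (sqr_ge0 (x - a 0 ord0 - a 0 ord0)); nra.
apply: eq_Rintegral => x _; rewrite -(intRdZ c20); last first.
  exact/gdom_gaussB/ltW.
congr intRd; apply/funext => y; rewrite /gauss -expRD -mulrDr.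
have e : (rv_cons x y - a) 0 ord0 = x - a 0 ord0 by rewrite mxE rv_cons0 mxE.
by rewrite sqnorm_recl rv_behead_consB e.
Qed.

Lemma poly_gauss_le c : 0 < c -> exists2 A, 0 <= A & forall d (y : 'rV[R]_d),
  (1 + sqnorm y) ^+ 2 * gauss c y <= A * gauss (c / 2) y.
Proof.
(* With $1+q \le (1+1/e)\,\exp(eq)$, squaring spends $2e = c/2$ of the rate. *)
move=> c0; pose e := c / 4; have e0 : 0 < e by rewrite divr_gt0.
exists ((1 + e^-1) ^+ 2) => [|d y]; first exact: sqr_ge0.
have H : 1 + sqnorm y <= (1 + e^-1) * expR (e * sqnorm y).
  apply: (@le_trans _ _ ((1 + e^-1) * (1 + e * sqnorm y))).
    rewrite mulrDr mulr1 mulrDl mul1r mulKf ?gt_eqF//.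
    have := mulr_ge0 (ltW e0) (sqnorm_ge0 y); have : 0 < e^-1 by rewrite invr_gt0.
    lra.
  by rewrite ler_wpM2l ?expR_ge1Dx// addr_ge0// invr_ge0 ltW.
apply: (@le_trans _ _ (((1 + e^-1) * expR (e * sqnorm y)) ^+ 2 * gauss c y)).
  rewrite ler_wpM2r ?(ltW (gauss_gt0 _ _))// ler_pXn2r// nnegrE.
    by rewrite addr_ge0// sqnorm_ge0.
  by rewrite mulr_ge0 ?expR_ge0// addr_ge0// invr_ge0 ltW.
rewrite exprMn -mulrA ler_wpM2l ?sqr_ge0// expr2 /gauss -!expRD ler_expR.
by rewrite /e; lra.
Qed.

(** For $p \le q$ the inequality $1+x \le e^x$ at $x=p-q$ gives the factor $e^{-p}$; the sum of both
    exponentials makes the bound symmetric. *)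
Lemma expR_lipschitz (p q : R) :
  `|expR (- p) - expR (- q)| <= `|p - q| * (expR (- p) + expR (- q)).
Proof.
wlog pq : p q / p <= q.
  move=> H; have [/H//|/ltW/H] := leP p q.
  by rewrite distrC [`|q - p|]distrC [expR (- q) + _]addrC.
rewrite ger0_norm ?subr_ge0 ?ler_expR ?lerN2// ler0_norm ?subr_le0// opprB.
apply: (@le_trans _ _ ((q - p) * expR (- p))); last first.
  by rewrite ler_wpM2l ?subr_ge0// lerDl expR_ge0.
have -> : - q = - p + (p - q) by ring.
rewrite expRD; have := ler_wpM2l (expR_ge0 (- p)) (expR_ge1Dx (p - q)); lra.
Qed.

Lemma gauss_lipschitz c d (u v : 'rV[R]_d) : 0 <= c ->
  `|gauss c u - gauss c v| <= c * `|sqnorm u - sqnorm v| * (gauss c u + gauss c v).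
Proof.
move=> c0; rewrite /gauss !mulNr.
by have := expR_lipschitz (c * sqnorm u) (c * sqnorm v); rewrite -mulrBr normrM ger0_norm.
Qed.

Lemma sqnorm_lipschitz d (y a b : 'rV[R]_d) (M e : R) :
  0 <= e -> sqnorm a <= M -> sqnorm b <= M ->
  (forall k, `|a 0 k - b 0 k| <= e) ->
  `|sqnorm (y - a) - sqnorm (y - b)| <= e * (sqnorm y + 2 * M + d%:R * 3).
Proof.
move=> e0 aM bM abe.
apply: (@le_trans _ _ (\sum_(k < d) e * (y 0 k ^+ 2 + a 0 k ^+ 2 + b 0 k ^+ 2 + 3))).
  rewrite /sqnorm /dotv -sumrB; apply: le_trans (ler_norm_sum _ _ _) _.
  apply: ler_sum => k _; rewrite !mxE.
  (* The second factor is quadratically bounded by $2|z| \le z^2+1$ for each of the three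
     coordinates, whence the constant 3. *)
  have -> : (y 0 k - a 0 k) * (y 0 k - a 0 k) - (y 0 k - b 0 k) * (y 0 k - b 0 k) =
    (a 0 k - b 0 k) * (a 0 k + b 0 k - 2 * y 0 k) by ring.
  rewrite normrM ler_pM//.
  have sq (z : R) : (2 * z <= z ^+ 2 + 1) * (- (2 * z) <= z ^+ 2 + 1) * (0 <= z ^+ 2).
    by rewrite sqr_ge0; split => //; have := sqr_ge0 (z - 1); have := sqr_ge0 (z + 1);
      split; nra.
  have := sq (a 0 k); have := sq (b 0 k); have := sq (y 0 k).
  move=> [[y1 y2] y3] [[b1 b2] b3] [[a1 a2] a3].
  by rewrite ler_norml; apply/andP; split; lra.
rewrite -mulr_sumr ler_wpM2l// !big_split/= sumr_const card_ord.
have E (z : 'rV[R]_d) : \sum_(k < d) z 0 k ^+ 2 = sqnorm z by [].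
by rewrite !E -mulr_natl; lra.
Qed.

End Gaussian.

(** * Gaussian mixtures *)

Section Derivatives.
Context {R : realType}.
Implicit Types (t a b c : R).

Lemma is_derive_mul (f g : R -> R) t a b :
  is_derive t 1 f a -> is_derive t 1 g b ->
  is_derive t 1 (fun s => f s * g s) (a * g t + f t * b).
Proof.
move=> fa gb; have H := is_deriveM fa gb.
by apply: (is_derive_eq H); rewrite addrC mulrC.
Qed.

Lemma is_derive_sumf (W : normedModType R) n (h : 'I_n -> R -> W) t (dh : 'I_n -> W) :
  (forall i, is_derive t 1 (h i) (dh i)) ->
  is_derive t 1 (fun s => \sum_(i < n) h i s) (\sum_(i < n) dh i).
Proof.
move=> hd; have := is_derive_sum hd.
by congr (is_derive _ _ _ _); apply/funext => s; rewrite fct_sumE.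
Qed.

Lemma is_derive_coord d (z : R -> 'rV[R]_d) t (z' : 'rV[R]_d) k :
  is_derive t 1 z z' -> is_derive t 1 (fun s => z s 0 k) (z' 0 k).
Proof.
move=> [dz <-]; rewrite derive_mx// mxE.
by apply: derivableP; exact: (derivable_mxP _ _ _).1.
Qed.

Lemma is_derive_sqnorm d (z : R -> 'rV[R]_d) t (z' : 'rV[R]_d) :
  (forall k, is_derive t 1 (fun s => z s 0 k) (z' 0 k)) ->
  is_derive t 1 (fun s => sqnorm (z s)) (2 * dotv (z t) z').
Proof.
move=> dz.
have H := is_derive_sumf (fun k => is_derive_mul (dz k) (dz k)).
by apply: (is_derive_eq H); rewrite mulr_sumr; apply: eq_bigr => k _; ring.
Qed.

Lemma is_derive_gauss d (z : R -> 'rV[R]_d) t (z' : 'rV[R]_d) c :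
  (forall k, is_derive t 1 (fun s => z s 0 k) (z' 0 k)) ->
  is_derive t 1 (fun s => gauss c (z s))
    (gauss c (z t) * (- c * (2 * dotv (z t) z'))).
Proof.
move=> /is_derive_sqnorm dz.
have /is_derive_mul/(_ dz) H := is_derive_cst (- c) t 1.
rewrite mul0r add0r in H.
exact: (is_derive1_comp (is_derive_expR _) H).
Qed.

End Derivatives.

(** * Mass, logarithmic growth and Lipschitz dependence of mixtures *)

Section Mixture.
Context {R : realType}.
Variables (d N : nat) (eps : R) (w : 'I_N -> R).
Hypotheses (eps0 : 0 < eps) (w0 : forall i, 0 < w i).
Implicit Types (x : 'I_N -> 'rV[R]_d) (y : 'rV[R]_d) (M : R).

(** A function of the configuration [x] rather than of time, so that estimates can be uniform over
    bounded configurations. *)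
Definition mix x y := \sum_(i < N) w i * psi eps (y - x i).

Definition peak : R := (2 * pi * eps) `^ (- (d%:R / 2)).
Definition rate : R := (2 * eps)^-1.
Definition mass : R := \sum_(i < N) w i.

Lemma rate_gt0 : 0 < rate.
Proof. by rewrite invr_gt0 mulr_gt0. Qed.

Lemma peak_gt0 : 0 < peak.
Proof. by rewrite powR_gt0// !mulr_gt0// pi_gt0. Qed.

Lemma mass_ge0 : 0 <= mass.
Proof. by apply: sumr_ge0 => i _; exact: ltW. Qed.

Lemma psiE y : psi eps y = peak * gauss rate y.
Proof. by rewrite /psi /gauss /rate !mulNr [X in expR (- X)]mulrC. Qed.

Lemma grad_psi y k : grad (psi eps (d:=d)) y 0 k =
  peak * (- (2 * rate) * y 0 k * gauss rate y).
Proof.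
(* The partial derivative is an ordinary derivative at 0 along this line. *)
pose z (h : R) : 'rV[R]_d := h *: delta_mx 0 k + y.
have dz j : is_derive (0 : R) 1 (fun h => z h 0 j) ((delta_mx 0 k : 'rV[R]_d) 0 j).
  have E : (fun h => z h 0 j) = (fun h => h * (delta_mx 0 k : 'rV[R]_d) 0 j + y 0 j).
    by apply/funext => h; rewrite /z !mxE.
  rewrite E; apply: is_derive_eq.
  by rewrite scaler0 add0r addr0 [LHS]mulr1.
have /is_derive_mul/(_ (is_derive_gauss rate dz)) [_ H] := is_derive_cst peak (0 : R) 1.
rewrite mxE; transitivity ('D_1 (fun h => peak * gauss rate (z h)) 0).
  rewrite /derive; congr (lim _).
  apply: (congr1 (fun F : R -> R => F h @[h --> 0^'])); apply/funext => h /=.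
  by rewrite !psiE /z scale0r add0r addr0 [h *: 1]mulr1.
rewrite H mul0r add0r /z scale0r add0r; congr (_ * _).
have -> : dotv y (delta_mx 0 k) = y 0 k.
  rewrite /dotv (bigD1 k)//= big1 => [|j jk]; first by rewrite mxE !eqxx mulr1 addr0.
  by rewrite mxE eqxx (negbTE jk) mulr0.
by ring.
Qed.

Lemma mix_gt0 x y : (0 < N)%N -> 0 < mix x y.
Proof.
move=> N0; rewrite /mix (bigD1 (Ordinal N0))//= ltr_pwDl//.
  by rewrite mulr_gt0// psiE mulr_gt0 ?peak_gt0 ?gauss_gt0.
by apply: sumr_ge0 => i _; rewrite mulr_ge0 ?(ltW (w0 _))// psiE
  mulr_ge0 ?(ltW peak_gt0)// ltW// gauss_gt0.
Qed.

Lemma gdom_mix x : gdom (rate / 2) (mix x).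
Proof.
apply: gdom_sum => i; apply: gdomZ; under eq_fun do rewrite psiE.
by apply: gdomZ; apply: gdom_gaussB; exact/ltW/rate_gt0.
Qed.

Lemma mix_seqcont x : seqcont (mix x).
Proof. by case: (gdom_mix x). Qed.

Lemma intRd_mix x x' : intRd (mix x) = intRd (mix x').
Proof.
have r20 : 0 < rate / 2 by rewrite divr_gt0// rate_gt0.
have gd (z : 'rV[R]_d) : gdom (rate / 2) (fun y => gauss rate (y - z)).
  exact/gdom_gaussB/ltW/rate_gt0.
have E z : intRd (mix z) = \sum_(i < N) w i * (peak *
    (\int[lebesgue_measure]_u expR (- rate * u ^+ 2)) ^+ d).
  rewrite /mix (intRd_sum r20) => [|i]; last first.
    by apply: gdomZ; under eq_fun do rewrite psiE; exact: gdomZ.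
  apply: eq_bigr => i _; rewrite (intRdZ r20); last first.
    by under eq_fun do rewrite psiE; exact: gdomZ.
  congr (_ * _); under eq_fun do rewrite psiE.
  by rewrite (intRdZ r20)// intRd_gaussB// rate_gt0.
by rewrite !E.
Qed.

(** Above, every Gaussian is at most its peak; below, a single particle is kept and its Gaussian
    bounded by [gauss_center_ge]. [B] depends on the configuration only through [M]. *)
Lemma ln_mix_le M : (0 < N)%N -> exists2 B, 0 <= B & forall x y,
  (forall i, sqnorm (x i) <= M) -> `|ln (mix x y)| <= B * (1 + sqnorm y).
Proof.
move=> N0; pose i0 := Ordinal N0; have r0 := rate_gt0; have p0 := peak_gt0.
exists (`|ln (mass * peak)| + `|ln (w i0 * peak)| + 2 * rate * `|M| + 2 * rate).
  by rewrite !addr_ge0// mulr_ge0// ?mulr_ge0// ltW.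
move=> x y xM; have m0 := mix_gt0 x y N0.
have W0 : 0 < mass.
  rewrite /mass (bigD1 i0)//= ltr_pwDl//.
  by apply: sumr_ge0 => i _; exact: ltW.
have ub : ln (mix x y) <= ln (mass * peak).
  rewrite ler_ln ?posrE// ?mulr_gt0// /mix /mass mulr_suml ler_sum// => i _.
  rewrite ler_wpM2l ?(ltW (w0 _))// psiE ler_piMr ?(ltW p0)//.
  by rewrite -expR0 ler_expR mulNr oppr_le0 mulr_ge0 ?sqnorm_ge0// ltW.
have lb : ln (w i0 * peak) - 2 * rate * (sqnorm y + M) <= ln (mix x y).
  rewrite -[X in _ - X]expRK -lnV ?posrE ?expR_gt0// -lnM ?posrE ?invr_gt0 ?expR_gt0//;
    last by rewrite mulr_gt0.
  rewrite ler_ln ?posrE// ?mulr_gt0 ?invr_gt0 ?expR_gt0// -expRN.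
  apply: (@le_trans _ _ (w i0 * psi eps (y - x i0))).
    rewrite psiE -mulrA ler_wpM2l ?(ltW (w0 _))// ler_wpM2l ?(ltW p0)//.
    apply: le_trans (gauss_center_ge y (x i0) (ltW r0)).
    by rewrite ler_expR mulNr lerN2 ler_wpM2l ?mulr_ge0 ?(ltW r0)// lerD2l.
  rewrite /mix (bigD1 i0)//= lerDl; apply: sumr_ge0 => i _.
  by rewrite mulr_ge0 ?(ltW (w0 _))// psiE mulr_ge0 ?(ltW p0)// ltW// gauss_gt0.
have M1 : 2 * rate * M <= 2 * rate * `|M|.
  by rewrite ler_wpM2l ?ler_norm// mulr_ge0// ltW.
have q0 := sqnorm_ge0 y.
have rM0 : 0 <= rate * `|M| by rewrite mulr_ge0// ltW.
have rq0 : 0 <= rate * sqnorm y by rewrite mulr_ge0// ltW.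
set U := `|ln (mass * peak)| in ub *; set L := `|ln (w i0 * peak)| in lb *.
have U1 : ln (mass * peak) <= U by exact: ler_norm.
have L1 : - L <= ln (w i0 * peak) by rewrite lerNl; apply: le_trans (ler_norm _) _; rewrite normrN.
have U0 : 0 <= U := normr_ge0 _.
have L0 : 0 <= L := normr_ge0 _.
have := mulr_ge0 U0 q0; have := mulr_ge0 L0 q0; have := mulr_ge0 rM0 q0.
by move=> h1 h2 h3; rewrite ler_norml; apply/andP; split; lra.
Qed.

Lemma mix_lipschitz M : 0 <= M -> exists2 B, 0 <= B & forall x x' e y, 0 <= e ->
  (forall i, sqnorm (x i) <= M) -> (forall i, sqnorm (x' i) <= M) ->
  (forall i k, `|x i 0 k - x' i 0 k| <= e) ->
  `|mix x y - mix x' y| <= B * e * (1 + sqnorm y) * gauss (rate / 2) y.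
Proof.
move=> M0; have r0 := rate_gt0; have p0 := peak_gt0.
(* Chosen so that $|y|^2 + 2M + 3d \le m(1+|y|^2)$. *)
pose m : R := 1 + 2 * M + d%:R * 3.
have m0 : 0 <= m by rewrite !addr_ge0// mulr_ge0.
exists (mass * (peak * (rate * m * (2 * expR (rate * M))))).
  by rewrite !mulr_ge0 ?mass_ge0 ?expR_ge0// ltW.
move=> x x' e y e0 xM x'M xx'; rewrite /mix -sumrB.
apply: le_trans (ler_norm_sum _ _ _) _; rewrite /mass !mulr_suml ler_sum// => i _.
rewrite -mulrBr !psiE -mulrBr !normrM (gtr0_norm (w0 i)) (gtr0_norm p0).
rewrite -!mulrA ler_wpM2l ?(ltW (w0 _))// ler_wpM2l ?(ltW p0)//.
apply: le_trans (gauss_lipschitz _ _ (ltW r0)) _.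
have g1 := le_trans (gauss_center_le y (x i) (ltW r0)) (ler_wpM2r (ltW (gauss_gt0 (rate / 2) y))
  (_ : _ <= expR (rate * M))).
have g2 := le_trans (gauss_center_le y (x' i) (ltW r0)) (ler_wpM2r (ltW (gauss_gt0 (rate / 2) y))
  (_ : _ <= expR (rate * M))).
have l1 : `|sqnorm (y - x i) - sqnorm (y - x' i)| <= e * (m * (1 + sqnorm y)).
  apply: le_trans (sqnorm_lipschitz y e0 (xM i) (x'M i) (xx' i)) _.
  rewrite ler_wpM2l// /m.
  have q0 := sqnorm_ge0 y; have := mulr_ge0 M0 q0.
  by have := mulr_ge0 (ler0n R d) q0; nra.
apply: (@le_trans _ _ (rate * (e * (m * (1 + sqnorm y))) *
  (2 * (expR (rate * M) * gauss (rate / 2) y)))); last first.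
  by rewrite le_eqVlt; apply/orP; left; apply/eqP; ring.
rewrite ler_pM ?mulr_ge0 ?addr_ge0 ?(ltW (gauss_gt0 _ _)) ?(ltW r0)//.
  by rewrite ler_wpM2l// ltW.
rewrite mulr2n mulrDl mul1r lerD//.
  by apply: g1; rewrite ler_expR ler_wpM2l// ltW.
by apply: g2; rewrite ler_expR ler_wpM2l// ltW.
Qed.

End Mixture.

(** * Time derivative of the entropy *)

Section Entropy.
Context {R : realType}.

Lemma gauss_ge_rate (c c' : R) d (y : 'rV[R]_d) :
  c' <= c -> gauss c y <= gauss c' y.
Proof. by move=> cc'; rewrite ler_expR !mulNr lerN2 ler_wpM2r// sqnorm_ge0. Qed.

Lemma gdom_le (c c' : R) d (f : 'rV[R]_d -> R) : c' <= c -> gdom c f -> gdom c' f.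
Proof.
move=> cc' [fc [C fC]]; split=> //; exists C => y; apply: le_trans (fC y) _.
by rewrite ler_wpM2l ?(gauss_dom_ge0 fC)// gauss_ge_rate.
Qed.

Lemma gdom_poly (c C : R) d (f : 'rV[R]_d -> R) : 0 < c -> 0 <= C -> seqcont f ->
  (forall y, `|f y| <= C * ((1 + sqnorm y) ^+ 2 * gauss c y)) -> gdom (c / 2) f.
Proof.
move=> c0 C0 fc fC; split=> //; have [A A0 HA] := poly_gauss_le c0.
exists (C * A) => y; apply: le_trans (fC y) _.
by rewrite -mulrA ler_wpM2l.
Qed.

(** The function $u\ln u-u$ is convex with derivative $\ln$; its tangent inequalities at [a] and at
    [b] bound the increment from both sides. *)
Lemma xlnx_lipschitz (a b : R) : 0 < a -> 0 < b ->
  `|(a * ln a - a) - (b * ln b - b)| <= `|a - b| * (`|ln a| + `|ln b|).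
Proof.
have H (x y : R) : 0 < x -> 0 < y -> (x * ln x - x) - (y * ln y - y) <= (x - y) * ln x.
  move=> x0 y0; have : ln x - ln y <= x / y - 1.
    rewrite -lnV ?posrE// -lnM ?posrE ?invr_gt0//.
    have := @le_ln1Dx _ (x / y - 1); rewrite addrCA subrr addr0; apply.
    by rewrite ltrBrDr addrC subrr divr_gt0.
  by move=> /(ler_wpM2l (ltW y0)); rewrite mulrBr mulrBr mulrCA divff ?gt_eqF// mulr1; lra.
move=> a0 b0; have h1 := H _ _ a0 b0; have h2 := H _ _ b0 a0.
have n1 := ler_norm ((a - b) * ln a); have n2 := ler_norm ((b - a) * ln b).
rewrite normrM in n1; rewrite normrM distrC in n2.
have p1 : 0 <= `|a - b| * `|ln a| by rewrite mulr_ge0.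
have p2 : 0 <= `|a - b| * `|ln b| by rewrite mulr_ge0.
by rewrite mulrDr ler_norml; apply/andP; split; lra.
Qed.

Variables (d N : nat) (eps : R) (w : 'I_N -> R).
Hypotheses (eps0 : 0 < eps) (w0 : forall i, 0 < w i) (N0 : (0 < N)%N).
Implicit Types (x : 'I_N -> 'rV[R]_d) (y : 'rV[R]_d) (M : R).
Local Notation mix := (mix eps w).
Local Notation r := (rate eps).

Let r0 : 0 < r. Proof. exact: rate_gt0. Qed.
Let r20 : 0 < r / 2. Proof. by rewrite divr_gt0. Qed.
Let r40 : 0 < r / 2 / 2. Proof. by rewrite divr_gt0. Qed.

Lemma sqnorm_config x i : sqnorm (x i) <= \sum_j sqnorm (x j).
Proof. by rewrite (bigD1 i)//= lerDl sumr_ge0// => j _; exact: sqnorm_ge0. Qed.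

Lemma ln_mix_seqcont x : seqcont (fun y => ln (mix x y)).
Proof.
apply: (seqcont_comp (g := @ln R)) => [y|]; last exact: mix_seqcont.
by apply: continuous_ln; exact: mix_gt0.
Qed.

(** [f] and the logarithm each bring a factor $1+|y|^2$. Absorbing the square halves the rate a
    second time, after the halving due to recentering. *)
Lemma gdom_mul_ln_mix x (f : 'rV[R]_d -> R) C : 0 <= C -> seqcont f ->
  (forall y, `|f y| <= C * (1 + sqnorm y) * gauss (r / 2) y) ->
  gdom (r / 2 / 2) (fun y => f y * ln (mix x y)).
Proof.
move=> C0 fc fC.
have [B B0 HB] := ln_mix_le d eps0 w0 (\sum_j sqnorm (x j)) N0.
apply: (@gdom_poly _ (C * B)) => // [||y]; first exact: mulr_ge0.
- by apply: seqcontM => //; exact: ln_mix_seqcont.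
- rewrite normrM; apply: le_trans (ler_pM _ _ (fC y) (HB x y _)) _ => //.
    exact: sqnorm_config.
  by rewrite le_eqVlt; apply/orP; left; apply/eqP; ring.
Qed.

Lemma gdom_mix_ln_mix x : gdom (r / 2 / 2) (fun y => mix x y * ln (mix x y)).
Proof.
have [mc [C mC]] := gdom_mix w eps0 x; have C0 := gauss_dom_ge0 mC.
apply: (@gdom_mul_ln_mix x (mix x) C) => // y; apply: le_trans (mC y) _.
rewrite ler_wpM2r ?(ltW (gauss_gt0 _ _))// ler_peMr// lerDl.
exact: sqnorm_ge0.
Qed.

Lemma gdom_mix4 x : gdom (r / 2 / 2) (mix x).
Proof. by apply: gdom_le (gdom_mix w eps0 x); have := r20; lra. Qed.

Lemma gdom_grad_psi_ln_mix x (a : 'rV[R]_d) k :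
  gdom (r / 2 / 2) (fun y => grad (psi eps (d:=d)) (a - y) 0 k * ln (mix x y)).
Proof.
have E y : grad (psi eps (d:=d)) (a - y) 0 k =
    peak d eps * (2 * r) * ((y - a) 0 k * gauss r (y - a)).
  by rewrite grad_psi// -opprB gaussN mxE; ring.
have p0 := peak_gt0 d eps0; have a0 := sqnorm_ge0 a.
apply: (@gdom_mul_ln_mix _ _
  (peak d eps * (2 * r) * ((2 + 2 * sqnorm a) * expR (r * sqnorm a)))).
- by rewrite !mulr_ge0 ?expR_ge0 ?addr_ge0 ?mulr_ge0// ltW.
- under eq_fun do rewrite E; apply: seqcontM; first exact: seqcont_cst.
  by apply: seqcontM; [exact: seqcont_coordB|exact: seqcont_gaussB].
move=> y; rewrite E normrM ger0_norm ?mulr_ge0 ?(ltW p0) ?(ltW r0)//.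
rewrite -!mulrA ler_wpM2l ?(ltW p0)// ler_wpM2l// ler_wpM2l ?(ltW r0)//.
rewrite normrM (gtr0_norm (gauss_gt0 _ _)).
have h1 : `|(y - a) 0 k| <= (2 + 2 * sqnorm a) * (1 + sqnorm y).
  apply: (@le_trans _ _ (1 + sqnorm (y - a))).
    apply: (@le_trans _ _ (1 + (y - a) 0 k ^+ 2)).
      have := sqr_ge0 ((y - a) 0 k - 1); have := sqr_ge0 ((y - a) 0 k + 1).
      have := sqr_ge0 ((y - a) 0 k).
      by move: ((y - a) 0 k) => z *; rewrite ler_norml; apply/andP; split; nra.
    rewrite lerD2l /sqnorm /dotv (bigD1 k)//= expr2 lerDl sumr_ge0// => j _.
    by rewrite -expr2 sqr_ge0.
  have := sqnorm_le_center (y - a) (- a); rewrite opprK subrK sqnormN.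
  by have := sqnorm_ge0 y; have := mulr_ge0 a0 (sqnorm_ge0 y); lra.
apply: le_trans (ler_pM _ _ h1 (gauss_center_le y a (ltW r0))) _ => //.
  by rewrite ltW// gauss_gt0.
by rewrite le_eqVlt; apply/orP; left; apply/eqP; ring.
Qed.

(** As $\nabla\psi_\varepsilon$ is odd, the minus sign of the chain rule is absorbed by evaluating
    at $v_i-y$, the argument occurring in [gradE]. *)
Lemma is_derive_mix (v : 'I_N -> R -> 'rV[R]_d) (t : R) (v' : 'I_N -> 'rV[R]_d) y :
  (forall i, is_derive t 1 (v i) (v' i)) ->
  is_derive t 1 (fun s => mix (v ^~ s) y)
    (\sum_i \sum_k w i * v' i 0 k * grad (psi eps (d:=d)) (v i t - y) 0 k).
Proof.
move=> dv.
have dz i k : is_derive t 1 (fun s => (y - v i s) 0 k) ((- v' i) 0 k).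
  have E : (fun s => (y - v i s) 0 k) = (fun s => y 0 k - v i s 0 k).
    by apply/funext => s; rewrite !mxE.
  have H := is_deriveB (is_derive_cst (y 0 k) t 1) (is_derive_coord k (dv i)).
  by rewrite E; apply: (is_derive_eq H); rewrite mxE sub0r.
have dg i := is_derive_mul (is_derive_cst (w i) t 1)
  (is_derive_mul (is_derive_cst (peak d eps) t 1) (is_derive_gauss r (dz i))).
have H := is_derive_sumf dg.
have E : (fun s => mix (v ^~ s) y) =
    (fun s => \sum_(i < N) cst (w i) s * (cst (peak d eps) s * gauss r (y - v i s))).
  by apply/funext => s; apply: eq_bigr => i _; rewrite psiE.
rewrite E; apply: (is_derive_eq H); apply: eq_bigr => i _.
rewrite mul0r add0r mul0r add0r /dotv !mulr_sumr; apply: eq_bigr => k _.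
by rewrite grad_psi// -opprB gaussN !mxE /cst; ring.
Qed.

Lemma near_config_lipschitz (v : 'I_N -> R -> 'rV[R]_d) (t : R) (v' : 'I_N -> 'rV[R]_d) :
  (forall i, is_derive t 1 (v i) (v' i)) ->
  exists2 L, 0 <= L & \forall s \near t, forall i k,
    `|v i s 0 k - v i t 0 k| <= L * `|s - t|.
Proof.
(* The sum dominates every single $|v'_{ik}|+1$; the added 1 is the margin by which difference
   quotients may exceed their limit. *)
move=> dv; exists (\sum_i \sum_k (`|v' i 0 k| + 1)).
  by apply: sumr_ge0 => i _; apply: sumr_ge0 => k _; rewrite addr_ge0.
set L := \sum_i _.
suff H i k : \forall s \near t, `|v i s 0 k - v i t 0 k| <= L * `|s - t|.
  exact: filter_forall _ (fun i => filter_forall _ (H i)).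
have [dvk E] := is_derive_coord k (dv i).
have q : h^-1 *: (v i (h *: 1 + t) 0 k - v i t 0 k) @[h --> 0^'] --> v' i 0 k.
  by rewrite -E; exact: dvk.
have : \forall h \near (0 : R), h != 0 ->
    `|h^-1 *: (v i (h *: 1 + t) 0 k - v i t 0 k)| < `|v' i 0 k| + 1.
  by apply: (cvgr_norm_lt _ q); rewrite ltrDl.
rewrite (near_shift t 0); apply: filterS => s /=; rewrite sub0r.
have [->|st] := eqVneq s t; first by rewrite !subrr normr0 mulr0.
rewrite subr_eq0 => /(_ st); rewrite [_ *: 1]mulr1 subrK => /ltW.
rewrite normrM normfV ler_pdivrMl ?normr_gt0 ?subr_eq0// mulrC => /le_trans; apply.
rewrite ler_wpM2r// /L (bigD1 i)//= (bigD1 k)//= -addrA lerDl addr_ge0//.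
  by apply: sumr_ge0 => j _; rewrite addr_ge0.
by apply: sumr_ge0 => i' _; apply: sumr_ge0 => j _; rewrite addr_ge0.
Qed.

Lemma is_derive_entropy (v : 'I_N -> R -> 'rV[R]_d) (t : R) (v' : 'I_N -> 'rV[R]_d) :
  (forall i, is_derive t 1 (v i) (v' i)) ->
  is_derive t 1 (entropyN eps w v)
    (\sum_i w i * dotv (v' i) (gradE eps w v t (v i t))).
Proof.
move=> dv; pose m s := mix (v ^~ s).
pose m' y := \sum_i \sum_k w i * v' i 0 k * grad (psi eps (d:=d)) (v i t - y) 0 k.
(* Subtracting [m] cancels the term $m'$ that the product rule leaves beside $m'\ln m$. *)
pose eta s y := m s y * ln (m s y) + (-1) * m s y.
have geta s : gdom (r / 2 / 2) (eta s).
  by apply: gdomD; [exact: gdom_mix_ln_mix|apply: gdomZ; exact: gdom_mix4].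
(* The subtracted mass is constant in time, so it is added back at the fixed time [t]. *)
have E : entropyN eps w v = (fun s => intRd (eta s) + intRd (m t)).
  apply/funext => s; rewrite (intRd_mix w eps0 _ (v ^~ s)) -(intRdD r40)//; last exact: gdom_mix4.
  by congr intRd; apply/funext => y; rewrite /eta mulN1r subrK.
have gm i k : gdom (r / 2 / 2)
    (fun y => grad (psi eps (d:=d)) (v i t - y) 0 k * ln (m t y)).
  exact: gdom_grad_psi_ln_mix.
have E' y : m' y * ln (m t y) = \sum_i \sum_k
    w i * v' i 0 k * (grad (psi eps (d:=d)) (v i t - y) 0 k * ln (m t y)).
  rewrite mulr_suml; apply: eq_bigr => i _; rewrite mulr_suml.
  by apply: eq_bigr => k _; rewrite mulrA.
have I' : intRd (fun y => m' y * ln (m t y)) =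
    \sum_i w i * dotv (v' i) (gradE eps w v t (v i t)).
  under eq_fun do rewrite E'.
  rewrite (intRd_sum r40) => [|i]; last by apply: gdom_sum => k; exact: gdomZ.
  apply: eq_bigr => i _; rewrite (intRd_sum r40) => [|k]; last exact: gdomZ.
  rewrite /dotv mulr_sumr; apply: eq_bigr => k _.
  by rewrite (intRdZ r40)// mxE mulrA.
have [L L0 HL] := near_config_lipschitz dv.
(* Bounds $|v_i(s)|^2 \le 2|v_i(t)|^2 + 2|v_i(s)-v_i(t)|^2$ for $|s-t|\le1$, where each of the [d]
   coordinates moves by at most [L]. *)
pose M := 2 * \sum_i sqnorm (v i t) + d%:R * (2 * L ^+ 2).
have M0 : 0 <= M.
  rewrite addr_ge0 ?mulr_ge0 ?sqr_ge0// ?sumr_ge0// => i _; exact: sqnorm_ge0.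
have [A A0 HA] := mix_lipschitz d eps0 w0 M0.
have [B B0 HB] := ln_mix_le d eps0 w0 M N0.
have [P P0 HP] := poly_gauss_le r20.
have H : is_derive t 1 (fun s => intRd (eta s)) (intRd (fun y => m' y * ln (m t y))).
  (* [A * L] comes from the increment of the mixture, [2 * B] from the two logarithms, [P] from
     absorbing the polynomial. *)
  apply: (is_derive_intRd r40 (C := 2 * A * L * B * P)) => //.
  - under eq_fun do rewrite E'.
    by have [] : gdom (r / 2 / 2) (fun y => \sum_i \sum_k
      w i * v' i 0 k * (grad (psi eps (d:=d)) (v i t - y) 0 k * ln (m t y)));
      first by apply: gdom_sum => i; apply: gdom_sum => k; exact: gdomZ.
  - move=> y; have dm := is_derive_mix y dv; have m0 : 0 < m t y by exact: mix_gt0.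
    have dl := is_derive1_comp (is_derive1_ln m0) dm.
    have d1 := is_derive_mul dm dl.
    have d2 := is_derive_mul (is_derive_cst (-1 : R) t 1) dm.
    have H := is_deriveD d1 d2; apply: (is_derive_eq H).
    by rewrite /= -/(m t) -/(m' y) mul0r add0r mulrA divff ?gt_eqF// mul1r mulN1r addrK.
  have near1 : \forall s \near t, `|s - t| <= 1.
    by apply: filterS (nbhsx_ballx t _ ltr01) => s; rewrite /ball/= distrC => /ltW.
  apply: filterS2 HL near1 => s HL s1 y.
  have st0 : 0 <= L * `|s - t| by rewrite mulr_ge0.
  have Mt i : sqnorm (v i t) <= M.
    have := sqnorm_config (v ^~ t) i; have := sqnorm_ge0 (v i t).
    have : 0 <= d%:R * (2 * L ^+ 2) by rewrite mulr_ge0// mulr_ge0// sqr_ge0.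
    by rewrite /M /=; lra.
  have Ms i : sqnorm (v i s) <= M.
    apply: (@le_trans _ _ (\sum_(k < d) (2 * (v i t 0 k) ^+ 2 + 2 * L ^+ 2))).
      apply: ler_sum => k _.
      have : (v i s 0 k - v i t 0 k) ^+ 2 <= L ^+ 2.
        rewrite -[leLHS]real_normK ?num_real// ler_pXn2r ?nnegrE//; apply: le_trans (HL i k) _.
        by rewrite ler_piMr.
      by have := sqr_ge0 (v i s 0 k - v i t 0 k - v i t 0 k); nra.
    rewrite big_split/= sumr_const card_ord -mulr_sumr -[_ *+ d]mulr_natl lerD2r.
    by rewrite ler_wpM2l//; exact: (sqnorm_config (v ^~ t)).
  have ms0 : 0 < m s y by exact: mix_gt0.
  have mt0 : 0 < m t y by exact: mix_gt0.
  rewrite /eta !mulN1r; apply: le_trans (xlnx_lipschitz ms0 mt0) _.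
  have h1 := HA _ _ _ y st0 Ms Mt HL.
  have h2 := lerD (HB _ y Ms) (HB _ y Mt).
  apply: le_trans (ler_pM _ _ h1 h2) _; rewrite ?addr_ge0//.
  apply: (@le_trans _ _ (2 * A * L * B * `|s - t| *
      ((1 + sqnorm y) ^+ 2 * gauss (r / 2) y))).
    by rewrite le_eqVlt; apply/orP; left; apply/eqP; ring.
  apply: le_trans (ler_wpM2l _ (HP _ y)) _; first by rewrite !mulr_ge0.
  by rewrite le_eqVlt; apply/orP; left; apply/eqP; ring.
rewrite E -I'; have := is_deriveD H (is_derive_cst (intRd (m t)) t 1).
by rewrite addr0.
Qed.

End Entropy.

(** * Collision matrix and weak form *)

Section Collision.
Context {R : realType}.
Variable d : nat.
Implicit Types (u v z p : 'rV[R]_d).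

Lemma dotvC u v : dotv u v = dotv v u.
Proof. by apply: eq_bigr => k _; rewrite mulrC. Qed.

Lemma dotvB u v p : dotv (u - v) p = dotv u p - dotv v p.
Proof. by rewrite /dotv -sumrB; apply: eq_bigr => k _; rewrite !mxE mulrBl. Qed.

Lemma dotvN u p : dotv u (- p) = - dotv u p.
Proof. by rewrite /dotv -sumrN; apply: eq_bigr => k _; rewrite !mxE mulrN. Qed.

Lemma dotvZ u (a : R) p : dotv u (a *: p) = a * dotv u p.
Proof. by rewrite /dotv mulr_sumr; apply: eq_bigr => k _; rewrite mxE mulrCA. Qed.

Lemma dotv_sum (I : finType) u (p : I -> 'rV[R]_d) :
  dotv u (\sum_i p i) = \sum_i dotv u (p i).
Proof.
rewrite /dotv exchange_big; apply: eq_bigr => k _.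
by rewrite summxE mulr_sumr.
Qed.

Lemma dotv_delta k p : dotv (delta_mx 0 k) p = p 0 k.
Proof.
rewrite /dotv (bigD1 k)//= big1 => [|j jk]; first by rewrite mxE !eqxx mul1r addr0.
by rewrite mxE eqxx (negbTE jk) mul0r.
Qed.

Lemma sqnorm_eq0 z : sqnorm z = 0 -> z = 0.
Proof.
move=> z0; apply/rowP => k; rewrite mxE; apply/eqP; rewrite -sqrf_eq0 expr2.
apply/eqP; apply: psumr_eq0P z0 k _ => // j _.
by rewrite -expr2 sqr_ge0.
Qed.

Lemma cauchy_schwarz u v : dotv u v ^+ 2 <= sqnorm u * sqnorm v.
Proof.
have [/sqnorm_eq0 ->|u0] := eqVneq (sqnorm u) 0.
  rewrite /dotv /sqnorm /dotv big1 => [|k _]; last by rewrite mxE mul0r.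
  by rewrite expr0n /= big1 ?mul0r// => k _; rewrite mxE mul0r.
have up : 0 < sqnorm u by rewrite lt_def u0 sqnorm_ge0.
(* This vector is $|u|^2$ times the component of [v] orthogonal to [u]. *)
have := sqnorm_ge0 (sqnorm u *: v - dotv u v *: u).
have -> : sqnorm (sqnorm u *: v - dotv u v *: u) =
    sqnorm u * (sqnorm u * sqnorm v - dotv u v ^+ 2).
  rewrite {1}/sqnorm dotvB !(dotvC (_ *: _)) !dotvZ !dotvB !(dotvC (_ *: _)) !dotvZ.
  by rewrite !(dotvC _ u) /sqnorm; ring.
by rewrite pmulr_rge0// subr_ge0.
Qed.

Variable gamma : R.

(** Carries the convention $A(0)=0$, so that the formula for [mxapp] below holds for every [z]. *)
Definition Acoef z : R := if z == 0 then 0 else enorm z `^ gamma.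

Lemma mxapp_Amat z p :
  mxapp (Amat gamma z) p = Acoef z *: (sqnorm z *: p - dotv z p *: z).
Proof.
rewrite /mxapp /Amat /Acoef; case: eqVneq => [_|_].
  by rewrite mul0mx trmx0 scale0r.
rewrite -scalemxAl linearZ /=; congr (_ *: _); rewrite mulmxBl linearB /=.
rewrite -scalemxAl mul1mx linearZ /= trmxK; congr (_ - _).
rewrite -mulmxA; apply/rowP => k; rewrite !mxE big_ord_recl big_ord0 addr0 !mxE mulrC.
by congr (_ * _); apply: eq_bigr => j _; rewrite !mxE.
Qed.

Lemma Acoef_ge0 z : 0 <= Acoef z.
Proof. by rewrite /Acoef; case: ifP => // _; exact: powR_ge0. Qed.

Lemma mxapp_Amat_odd z p : mxapp (Amat gamma (- z)) (- p) = - mxapp (Amat gamma z) p.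
Proof.
rewrite !mxapp_Amat /Acoef /enorm oppr_eq0 sqnormN -[RHS]scalerN; congr (_ *: _).
have -> : dotv (- z) (- p) = dotv z p by apply: eq_bigr => k _; rewrite !mxE mulrNN.
by rewrite !scalerN opprB opprK addrC.
Qed.

Lemma dotv_mxapp_Amat_kernel z p : dotv z (mxapp (Amat gamma z) p) = 0.
Proof.
rewrite mxapp_Amat dotvZ dotvC dotvB !(dotvC (_ *: _)) !dotvZ.
by rewrite -/(sqnorm z) (mulrC (sqnorm z)) subrr mulr0.
Qed.

(** The quadratic form is [Acoef z] times the defect $|z|^2|p|^2-(z\cdot p)^2$ in Cauchy-Schwarz. *)
Lemma dotv_mxapp_Amat_ge0 z p : 0 <= dotv p (mxapp (Amat gamma z) p).
Proof.
rewrite mxapp_Amat dotvZ mulr_ge0 ?Acoef_ge0//.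
rewrite dotvC dotvB !(dotvC (_ *: _)) !dotvZ -/(sqnorm p) (dotvC p z) subr_ge0.
by rewrite -expr2 cauchy_schwarz.
Qed.

(** The test vectors [a] and the vectors [g] are arbitrary, so one identity serves momentum, energy
    and entropy. *)
Lemma weak_form N (w : 'I_N -> R) (x g a : 'I_N -> 'rV[R]_d) :
  \sum_i w i * dotv (a i)
    (- \sum_j w j *: mxapp (Amat gamma (x i - x j)) (g i - g j)) =
  - (2^-1 * \sum_i \sum_j w i * w j *
      dotv (a i - a j) (mxapp (Amat gamma (x i - x j)) (g i - g j))).
Proof.
pose S i j := mxapp (Amat gamma (x i - x j)) (g i - g j).
have SN i j : S i j = - S j i by rewrite /S -mxapp_Amat_odd !opprB.
pose X := \sum_i \sum_j w i * w j * dotv (a i) (S i j).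
have -> : \sum_i \sum_j w i * w j * dotv (a i - a j) (S i j) = X + X.
  (* Swapping the indices in one copy of [X] and using antisymmetry turns $a_i$ into $-a_j$. *)
  have {2}-> : X = \sum_i \sum_j w j * w i * dotv (a j) (S j i) by exact: exchange_big.
  rewrite -big_split; apply: eq_bigr => i _ /=; rewrite -big_split.
  by apply: eq_bigr => j _ /=; rewrite dotvB (SN j i) dotvN; ring.
have -> : 2^-1 * (X + X) = X by field.
rewrite /X -sumrN; apply: eq_bigr => i _.
rewrite dotvN dotv_sum mulrN mulr_sumr; congr (- _); apply: eq_bigr => j _.
by rewrite dotvZ mulrA.
Qed.

End Collision.

(** * Conservation laws and entropy dissipation *)

Theorem theorem10 (R : realType) (d N : nat) (gamma eps : R)
  (w : 'I_N -> R) (v : 'I_N -> R -> 'rV[R]_d) (T : set R) :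
  (2 <= d)%N -> 0 < eps -> (forall i, 0 < w i) ->
  open T ->
  (forall t, T t -> forall i,
     is_derive t 1 (v i) (particle_rhs gamma eps w v t i)) ->
  forall t, T t ->
    [/\ is_derive t 1 (fun s : R => \sum_(i < N) w i * 1) 0,
        is_derive t 1 (fun s : R => \sum_(i < N) w i *: v i s) 0,
        is_derive t 1 (fun s : R => \sum_(i < N) w i * sqnorm (v i s)) 0,
        is_derive t 1 (entropyN eps w v) (- dissipN gamma eps w v t)
      & 0 <= dissipN gamma eps w v t].
Proof.
move=> _ eps0 w0 _ dv t /dv {}dv.
pose g i := gradE eps w v t (v i t).
have wf a := weak_form gamma w (v ^~ t) g a.
split.
- exact: is_derive_cst.
- have H := is_derive_sumf (fun i => is_deriveZ (w i) (dv i)).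
  apply: (is_derive_eq H); apply/rowP => k; rewrite summxE [RHS]mxE.
  (* Coordinate [k] of momentum is the weak form tested with a constant basis vector. *)
  transitivity (\sum_i w i * dotv (delta_mx 0 k) (particle_rhs gamma eps w v t i)).
    by apply: eq_bigr => i _; rewrite dotv_delta mxE.
  rewrite (wf (fun=> delta_mx 0 k)) big1 ?mulr0 ?oppr0// => i _.
  by apply: big1 => j _; rewrite dotvB subrr mulr0.
- have H := is_derive_sumf (fun i => is_derive_mul (is_derive_cst (w i) t 1)
    (is_derive_sqnorm (fun k => is_derive_coord k (dv i)))).
  apply: (is_derive_eq H).
  (* Energy is tested with $a_i=v_i$, where $A(v_i-v_j)$ annihilates $v_i-v_j$. *)
  transitivity (2 * \sum_i w i * dotv (v i t) (particle_rhs gamma eps w v t i)).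
    by rewrite mulr_sumr; apply: eq_bigr => i _; rewrite mul0r add0r /cst mulrCA.
  rewrite (wf (v ^~ t)) big1 ?mulr0 ?oppr0 ?mulr0// => i _.
  by apply: big1 => j _; rewrite dotv_mxapp_Amat_kernel mulr0.
(* Without particles the mixture is zero and the entropy constant in time; otherwise the mixture is
   positive and its logarithm differentiable. *)
- have [N0|N0] := posnP N.
    subst N; have -> : entropyN eps w v = cst (entropyN eps w v t).
      have f0 s : fNpsi eps w v s = fNpsi eps w v t.
        by apply/funext => y; rewrite /fNpsi !big_ord0.
      by apply/funext => s; rewrite /entropyN f0.
    by rewrite /dissipN big_ord0 mulr0 oppr0; exact: is_derive_cst.
  have H := is_derive_entropy eps0 w0 N0 dv.
  (* Testing with $a_i=g_i$ yields exactly minus the dissipation. *)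
  apply: (is_derive_eq H); rewrite -[RHS](wf g).
  by apply: eq_bigr => i _; rewrite dotvC.
- rewrite mulr_ge0 ?invr_ge0// sumr_ge0// => i _; rewrite sumr_ge0// => j _.
  by rewrite !mulr_ge0 ?(ltW (w0 _))// dotv_mxapp_Amat_ge0.
Qed.
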